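(* Let $q\geq 1$ and $m\geq 0$ be integers, let $G$ be a finite simple graph with more than $m$ vertices, and let $S_1, S_2, \ldots, S_{m}$ be squids in $G\square K_q$ with pairwise different bodies. If $q> |N^2(v)| + 2|N(v)|$ for every vertex $v$ of $G$, then $\mathtt{Ind}(G\square K_q\setminus \bigcup_{i=1}^m S_i)$ is $(|V(G)|-m-2)$--connected.
   Context: $K_q$ is the complete graph on vertex set $\{1,2,\ldots,q\}$. For graphs $G,H$ the cartesian product $G\square H$ has vertex set $V(G)\times V(H)$, with $(v_1,w_1)$ and $(v_2,w_2)$ adjacent iff either $w_1=w_2$ and $\{v_1,v_2\}\in E(G)$, or $v_1=v_2$ and $\{w_1,w_2\}\in E(H)$. For a vertex $v$ of $G$, $N_G(v)=N(v)$ is the set of neighbours of $v$ in $G$, and $N^2(v)=\left(\bigcup_{u\in N(v)} N(u)\right)\setminus (N(v)\cup\{v\})$. A squid with body $w\in V(G)$ in $G\square K_q$ is a subset of $V(G\square K_q)$, together with the designated body $w$, which is either (i) a subset of $(N_G(v)\cup N_G(w))\times\{i\} \cup \{w\}\times\{1,\ldots, q\}$ for some vertex $v$ adjacent to $w$ and some $1\leq i\leq q$, or (ii) a subset of $N_G(w)\times\{i,j\} \cup \{w\}\times\{1,\ldots, q\}$ for some $1\leq i<j\leq q$. $G\square K_q\setminus S$ denotes the induced subgraph on the complement of the vertex set $S$. The independence complex $\mathtt{Ind}(H)$ of a graph $H$ is the simplicial complex on $V(H)$ whose faces are the independent sets of $H$. A simplicial complex $\Delta$ is $n$--connected if for all $0\leq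 i\leq n$ every continuous map from the $i$--sphere to $\Delta$ extends to a continuous map from the $(i+1)$--ball to $\Delta$; in addition, $\Delta$ is $(-1)$--connected exactly when it is non-empty. *)

(* Defs.v *)
From HB Require Import structures.
From mathcomp Require Import all_boot all_order all_algebra.
From mathcomp Require Import all_classical all_reals.
From mathcomp Require Import topology normedtype.

Set Implicit Arguments.
Unset Strict Implicit.
Unset Printing Implicit Defensive.

Import Order.TTheory GRing.Theory Num.Theory.
Import numFieldNormedType.Exports.

Record sgraph := SGraph {
  vertex :> finType;
  adj : rel vertex;
  adj_sym : symmetric adj;
  adj_irr : irreflexive adj }.

Section Graphs.
Local Open Scope set_scope.

Lemma complete_sym q : symmetric [rel i j : 'I_q | i != j].
Proof. by move=> i j /=; rewrite eq_sym. Qed.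

Lemma complete_irr q : irreflexive [rel i j : 'I_q | i != j].
Proof. by move=> i /=; rewrite eqxx. Qed.

(* The vertices 1, ..., q of K_q are represented by 0, ..., q - 1. *)
Definition complete q : sgraph :=
  SGraph (@complete_sym q) (@complete_irr q).

Definition cart_adj (G H : sgraph) : rel (G * H) := fun x y =>
  ((x.2 == y.2) && adj x.1 y.1) || ((x.1 == y.1) && adj x.2 y.2).

Lemma cart_sym (G H : sgraph) : symmetric (@cart_adj G H).
Proof.
move=> x y; rewrite /cart_adj (eq_sym x.2) (eq_sym x.1).
by rewrite (@adj_sym G x.1) (@adj_sym H x.2).
Qed.

Lemma cart_irr (G H : sgraph) : irreflexive (@cart_adj G H).
Proof. by move=> x; rewrite /cart_adj !adj_irr !andbF. Qed.

Definition cart (G H : sgraph) : sgraph :=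
  SGraph (@cart_sym G H) (@cart_irr G H).

Lemma delete_sym (G : sgraph) (S : {set G}) :
  symmetric [rel x y : {x : G | x \notin S} | adj (val x) (val y)].
Proof. by move=> x y /=; rewrite adj_sym. Qed.

Lemma delete_irr (G : sgraph) (S : {set G}) :
  irreflexive [rel x y : {x : G | x \notin S} | adj (val x) (val y)].
Proof. by move=> x /=; rewrite adj_irr. Qed.

Definition delete (G : sgraph) (S : {set G}) : sgraph :=
  SGraph (@delete_sym G S) (@delete_irr G S).

Definition nbh (G : sgraph) (v : G) : {set G} := [set u | adj v u].

Definition nbh2 (G : sgraph) (v : G) : {set G} :=
  (\bigcup_(u in nbh v) nbh u) :\: (nbh v :|: [set v]).

Definition is_squid (G : sgraph) (q : nat) (w : G)
    (S : {set cart G (complete q)}) : Prop :=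
  (exists (v : G) (i : 'I_q), adj v w /\
     S \subset finset.setX (nbh v :|: nbh w) [set i] :|: finset.setX [set w] [set: 'I_q])
  \/
  (exists i j : 'I_q, (i < j)%N /\
     S \subset finset.setX (nbh w) [set i; j] :|: finset.setX [set w] [set: 'I_q]).

(* The empty face is allowed. *)
Record scomplex (V : finType) := SComplex {
  faces : {set {set V}};
  faces_down : forall A B : {set V}, A \in faces -> B \subset A -> B \in faces }.

Definition independent (H : sgraph) (A : {set H}) : bool :=
  [forall u in A, forall v in A, ~~ adj u v].

Lemma independent_down (H : sgraph) (A B : {set H}) :
  A \in [set A | independent A] -> B \subset A ->
  B \in [set A | independent A].
Proof.
rewrite !inE => /forall_inP indA /fintype.subsetP sBA.
apply/forall_inP => u uB; apply/forall_inP => v vB.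
by have /forall_inP := indA u (sBA u uB); apply; exact: sBA.
Qed.

Definition Ind (H : sgraph) : scomplex H := SComplex (@independent_down H).

End Graphs.

Section Topology.
Local Open Scope classical_set_scope.
Local Open Scope ring_scope.

(* The geometric realization, in barycentric coordinates; R^V carries the
   product topology, which for finite V is the usual one. *)
Definition realization (R : realType) (V : finType) (D : scomplex V) :
    set {ptws V -> R} :=
  [set x | [/\ forall v, 0 <= x v, \sum_(v : V) x v = 1
            & ([set v | x v != 0]%SET \in faces D)]].
Arguments realization R {V} D.

Definition sphere (R : realType) (i : nat) : set 'rV[R]_i.+1 :=
  [set x | \sum_(j < i.+1) x 0 j ^+ 2 = 1].
Arguments sphere R i : clear implicits.

Definition disk (R : realType) (k : nat) : set 'rV[R]_k :=
  [set x | \sum_(j < k) x 0 j ^+ 2 <= 1].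
Arguments disk R k : clear implicits.

(* The first conjunct is the usual extension condition for the empty sphere in
   dimension -1; thus an n-connected space with n >= -1 is nonempty, and every
   space is n-connected for n <= -2. *)
Definition n_connected (R : realType) (T : topologicalType) (X : set T)
    (n : int) : Prop :=
  (-1 <= n -> X !=set0) /\
  forall i : nat, i%:Z <= n ->
  forall f : 'rV[R]_i.+1 -> T,
    {within sphere R i, continuous f} -> f @` sphere R i `<=` X ->
  exists g : 'rV[R]_i.+1 -> T,
    [/\ {within disk R i.+1, continuous g}, g @` disk R i.+1 `<=` X
      & {in sphere R i, f =1 g}].

Definition scomplex_connected (R : realType) (V : finType) (D : scomplex V)
    (n : int) : Prop :=
  n_connected R (realization R D) n.

End Topology.

(* Main.v *)
(** Instead of homotopies of spheres, the proof extends closed covers. A map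
    from a compact set [Z] to [Ind H] is encoded by a closed cover of [Z]
    indexed by the vertices of [H] in which adjacent vertices have disjoint
    sets. For a compact [Y] containing [Z] of dimension at most [k - 1],
    [cover_ext R A k] lets every such cover of [Z] by vertices of [A] be
    extended to [Y]; a partition of unity then turns it into
    [(k - 2)]-connectedness.

    Covers glue as complexes do: if [Ind (A - x)] has the property for [k + 1]
    and [Ind (A - N[x])] has it for [k], then [Ind A] has it for [k + 1]. One
    separates the set of [x] from the sets of its neighbours by some [M] of
    smaller dimension, extends first to [M] within the link of [x], and then to
    the two sides of [M] within [A - x] and within the star of [x].

    For squids, induct on the number [k] of vertices of [G] that are not bodies.
    Pick such a vertex [u] and a colour [c] with [(u, c)] not removed. Delete
    first the vertices [(v, c)] with [v] in [N(u)], then the vertices [(u, d)]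
    with [d <> c]. Each link is the complement of squids with one more body, and
    in the end [(u, c)] is isolated, so that the complex is a cone. *)

Require Import Defs.
From mathcomp Require Import all_boot all_order all_algebra.
From mathcomp Require Import all_classical all_reals.
From mathcomp Require Import topology normedtype.
From mathcomp Require Import derive realfun finmap zify lra.

Set Implicit Arguments.
Unset Strict Implicit.
Unset Printing Implicit Defensive.

Import Order.TTheory GRing.Theory Num.Theory.
Import numFieldNormedType.Exports.

Local Open Scope classical_set_scope.
Local Open Scope ring_scope.

(** * Separation by sets of smaller dimension *)

(** [phi] is the distance to [C], or the constant 1 if [C] is empty. *)
Lemma closed_zero_set (R : realType) (V : normedModType R) (C : set V) :
  closed C ->
  exists phi : V -> R,
    [/\ continuous phi, forall y, 0 <= phi y & forall y, phi y = 0 <-> C y].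
Proof.
move=> cC; have [->|/set0P[c0 Cc0]] := eqVneq C set0.
  exists (fun=> 1); split=> [?|y|y]; [exact: cvg_cst|exact: ler01|].
  by split=> // /eqP; rewrite oner_eq0.
pose D y := [set `|y - c| | c in C].
have D0 y : D y !=set0 by exists `|y - c0|, c0.
have Dlb y : has_lbound (D y) by exists 0 => _ [c _ <-].
have phi_lip x y : inf (D x) <= `|x - y| + inf (D y).
  rewrite -lerBlDl; apply: lb_le_inf => // _ [c Cc <-].
  rewrite lerBlDl; apply: (@le_trans _ _ `|x - c|).
    by apply: ge_inf => //; exists c.
  have -> : x - c = (x - y) + (y - c) by rewrite addrA subrK.
  exact: ler_normD.
have phi_ge0 y : 0 <= inf (D y) by apply: lb_le_inf => // _ [c _ <-].
exists (fun y => inf (D y)); split=> //.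
  move=> x; apply/cvgrPdist_lt => e e0; near=> y.
  apply: (@le_lt_trans _ _ `|x - y|); last first.
    by near: y; exact: cvgr_dist_lt.
  rewrite ler_distl lerBlDl (distrC x y) phi_lip /=.
  by rewrite addrC distrC phi_lip.
move=> y; split=> [y0|Cy]; last first.
  apply/eqP; rewrite eq_le phi_ge0 andbT; apply: ge_inf => //.
  by exists y => //; rewrite subrr normr0.
move/closure_id: (cC) => -> B /nbhs_ballP[e /= e0 eB].
have [_ [c Cc <-] ce] := inf_adherent e0 (conj (D0 y) (Dlb y)).
exists c; split=> //; apply: eB; rewrite -ball_normE /=.
by rewrite y0 add0r in ce.
Unshelve. all: by end_near. Qed.

Lemma compact_pos_lb (R : realType) (T : topologicalType) (K : set T)
    (phi : T -> R) :
  compact K -> {within K, continuous phi} -> (forall y, K y -> 0 < phi y) ->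
  exists2 e : R, 0 < e & forall y, K y -> e <= phi y.
Proof.
move=> cK cphi phi0; have [->|/set0P K0] := eqVneq K set0; first by exists 1.
have [c /set_mem Kc cmin] := compact_EVT_min K0 cK cphi.
by exists (phi c) => [|y Ky]; [exact: phi0|apply: cmin; exact: mem_set].
Qed.

Lemma fin_common_pos (R : realType) (I : finType) (Q : I -> R -> Prop) :
  (forall i e e', 0 < e' -> e' <= e -> Q i e -> Q i e') ->
  (forall i, exists2 e, 0 < e & Q i e) ->
  exists2 e, 0 < e & forall i, Q i e.
Proof.
move=> mono ex; pose h i := s2val (cid2 (ex i)).
have h0 i : 0 < h i := s2valP (cid2 (ex i)).
have Qh i : Q i (h i) := s2valP' (cid2 (ex i)).
have e0 : 0 < \big[Order.min/1]_i h i by apply/bigmin_gtP; split.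
exists (\big[Order.min/1]_i h i) => // i.
by apply: mono (Qh i) => //; exact: bigmin_le.
Qed.

Lemma avoid_seq (R : realType) (e : R) (s : seq R) :
  0 < e -> exists r, [/\ 0 < r, r < e & r \notin s].
Proof.
elim: s e => [|a s IH] e e0; first by exists (e / 2); split=> //; lra.
have [a0|a0] := leP a 0.
  have [r [r0 re rs]] := IH e e0; exists r; split=> //.
  by rewrite inE negb_or rs andbT; apply/eqP; lra.
have [|r [r0 + rs]] := IH (Order.min e a); first by rewrite lt_min e0.
rewrite lt_min => /andP[re ra]; exists r; split=> //.
by rewrite inE negb_or rs andbT; apply/eqP; lra.
Qed.

Lemma closed_le_fun (R : realType) (T : topologicalType) (f g : T -> R) :
  continuous f -> continuous g -> closed [set y | f y <= g y].
Proof.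
move=> cf cg.
have -> : [set y | f y <= g y] = (g \- f) @^-1` [set r | 0 <= r].
  by apply/seteqP; split=> y /=; rewrite subr_ge0.
apply: preimage_closed => [y _|]; last exact: closed_ge.
by apply: cvgB; [exact: cg|exact: cf].
Qed.

(* The compact sets [Y] with [thin c Y] have dimension at most [n - c]: they lie
   in the [(n - c)]-skeleton of a grid. *)
Definition thin (R : realType) (n c : nat) (Y : set 'rV[R]_n) : Prop :=
  exists T : 'I_n -> seq R,
    forall y, Y y -> (c <= #|[set j | y 0%R j \in T j]%SET|)%N.

Lemma thin0 (R : realType) (n : nat) (Y : set 'rV[R]_n) : thin 0 Y.
Proof. by exists (fun=> [::]). Qed.

Lemma dist_continuous (R : realType) (V : normedModType R) (p : V) :
  continuous (fun y : V => `|p - y|).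
Proof.
move=> y; apply: cvg_norm; apply: cvgB; [exact: cvg_cst|exact: cvg_id].
Qed.

(** Balls of the maximum norm are cubes. Finitely many of them cover [P] and miss [Q]; [Y1] is the
    part of [Y] in the closed cubes, [Y2] the part outside the open ones. A common point lies on a
    face of some cube, and the faces avoid the old grid, so the point gains a grid coordinate. *)
Lemma thin_separation (R : realType) (n c : nat) (Y P Q : set 'rV[R]_n) :
  compact Y -> closed P -> closed Q -> P `<=` Y ->
  (forall y, P y -> Q y -> False) -> thin c Y ->
  exists Y1 Y2 : set 'rV[R]_n,
    [/\ closed Y1 /\ closed Y2, Y = Y1 `|` Y2,
        forall y, P y -> Y2 y -> False, forall y, Q y -> Y1 y -> False
      & thin c.+1 (Y1 `&` Y2)].
Proof.
move=> cY clP clQ PY PQ [T thT].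
have clY : closed Y by apply: compact_closed => //; exact: norm_hausdorff.
have cP : compact P by exact: subclosed_compact cY PY.
(* The last condition says that no face of the cube around [p] lies in a hyperplane of the grid
   [T]. *)
have rad (p : 'rV[R]_n) : exists r : R, P p -> [/\ 0 < r,
    forall y, Q y -> `|p - y| <= r -> False &
    forall j t, t \in T j -> `|p 0 j - t| != r].
  have [Pp|nPp] := pselect (P p); last by exists 0.
  have [e e0 eQ] : exists2 e : R, 0 < e &
      forall y, Q y -> `|p - y| < e -> False.
    have : nbhs p (~` Q).
      by apply: open_nbhs_nbhs; split; [exact: closed_openC|exact: PQ].
    move=> /nbhs_ballP[e /= e0 eQ]; exists e => // y Qy pye.
    by apply: (eQ y) => //; rewrite -ball_normE.
  have [r [r0 re rs]] := avoid_seq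
    (flatten [seq [seq `|p 0 j - t| | t <- T j] | j <- enum 'I_n]) e0.
  exists r => _; split=> // [y Qy pyr|j t tT].
    by apply: eQ Qy _; exact: le_lt_trans re.
  apply: contra rs => /eqP <-; apply/flattenP.
  exists [seq `|p 0 j - t| | t <- T j]; last exact: map_f.
  by apply/mapP; exists j; rewrite ?mem_enum.
have [rho rhoP] := choice rad.
move: cP; rewrite compact_cover => /(_ _ P (fun p => ball p (rho p))).
case=> [p _|p Pp|F FP PF]; first exact: ball_open.
  by exists p => //; apply: ballxx; have [] := rhoP p Pp.
have FPp p : p \in F -> P p by move=> /FP /set_mem.
pose Y1 := Y `&` \bigcup_(p in [set` F]) [set y | `|p - y| <= rho p].
pose Y2 := Y `&` \bigcap_(p in [set` F]) [set y | rho p <= `|p - y|].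
have cn (p : 'rV[R]_n) : continuous (fun y : 'rV[R]_n => `|p - y|).
  exact: dist_continuous.
exists Y1, Y2; split.
- split; apply: closedI => //.
    apply: closed_bigcup => [|p _]; first exact: finite_fset.
    by apply: closed_le_fun => //; exact: cst_continuous.
  apply: closed_bigI => p _.
  by apply: closed_le_fun => //; exact: cst_continuous.
- rewrite -setIUr; apply/esym/setIidPl => y Yy.
  have [ex|nex] := pselect (exists2 p, p \in F & `|p - y| <= rho p).
    by left; case: ex => p; exists p.
  right=> p pF /=; rewrite leNgt; apply/negP => lt; apply: nex.
  by exists p => //; exact: ltW.
- move=> y Py [_ Y2y]; have [p pF] := PF y Py.
  rewrite -ball_normE /= => lt; have := Y2y p pF; rewrite /= leNgt.
  by rewrite lt.
- move=> y Qy [_ [p pF /= le]].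
  by have [_ /(_ y Qy le)] := rhoP p (FPp p pF).
exists (fun j => T j ++ flatten
  [seq [:: p 0 j - rho p; p 0 j + rho p] | p : 'rV[R]_n <- F]).
move=> y [[Yy [p pF /= le]] [_ /(_ p pF) /= ge]].
have eqr : `|p - y| = rho p by apply/eqP; rewrite eq_le le ge.
have [r0 _ rT] := rhoP p (FPp p pF).
(* The norm is attained at a coordinate [j], so [y 0 j] is one of the new grid values, and by [rT]
   it is not in [T j]. *)
have [[i j] ij] : exists ij, `|p - y| = `|(p - y) ij.1 ij.2|.
  by apply: mx_norm_neq0; rewrite -[mx_norm _]/(`|p - y|) eqr gt_eqF.
move: ij; rewrite ord1 !mxE /= eqr => ij.
apply: (@leq_trans #|j |: [set j | y 0 j \in T j]|%SET); last first.
  apply/subset_leq_card/fintype.subsetP => l; rewrite !inE mem_cat.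
  case/orP=> [/eqP ->|->//]; apply/orP; right; apply/flattenP.
  exists [:: p 0 j - rho p; p 0 j + rho p]; first by apply: map_f.
  rewrite !inE ij; case: (ger0P (p 0 j - y 0 j)) => _.
    by apply/orP; left; apply/eqP; lra.
  by apply/orP; right; apply/eqP; lra.
rewrite cardsU1 inE; case: (boolP (_ \in _)) => [yT|_].
  by have := rT j _ yT; rewrite ij eqxx.
by rewrite ltnS thT.
Qed.

(** * Extension of independent covers *)

Definition indep_cover (R : realType) (n : nat) (H : sgraph) (A : {set H})
    (Y : set 'rV[R]_n) (C : H -> set 'rV[R]_n) : Prop :=
  [/\ forall v, closed (C v), forall v y, C v y -> v \in A /\ Y y,
      forall y, Y y -> exists v, C v y
    & forall v w y, adj v w -> C v y -> C w y -> False].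

(** The dimension bound is [n < c + k]. On [Z] the new cover need only refine the old one: the maps
    they encode are joined by convex combinations in the end. *)
Definition cover_ext (R : realType) (H : sgraph) (A : {set H}) (k : nat) :
    Prop :=
  forall (n c : nat) (Y Z : set 'rV[R]_n) (C : H -> set 'rV[R]_n),
  compact Y -> thin c Y -> (n < c + k)%N -> closed Z -> Z `<=` Y ->
  indep_cover A Z C ->
  exists2 D, indep_cover A Y D & forall v y, Z y -> D v y -> C v y.

(** Here [n < c], while a point has only [n] coordinates, so [Y] is empty. *)
Lemma cover_ext0 (R : realType) (H : sgraph) (A : {set H}) : cover_ext R A 0.
Proof.
move=> n c Y Z C _ [T thT]; rewrite addn0 => nc _ ZY _.
have Y0 y : Y y -> False.
  move=> /thT ce; have := leq_trans nc (leq_trans ce (max_card _)).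
  by rewrite card_ord ltnn.
exists (fun=> set0) => //; split=> // [v|y /Y0 //].
exact: closed0.
Qed.

(** For adjacent [v] and [w] the sum of [phi v] and [phi w] is positive on the compact [Y], hence
    bounded below. So the sets of the cover can be thickened by [e] within [Y] and adjacent ones
    stay disjoint. *)
Lemma indep_cover_sep (R : realType) (n : nat) (H : sgraph) (A : {set H})
    (Y Z : set 'rV[R]_n) (C : H -> set 'rV[R]_n) :
  compact Y -> Z `<=` Y -> indep_cover A Z C ->
  exists (phi : H -> 'rV[R]_n -> R) (e : R),
    [/\ forall v, continuous (phi v), forall v y, phi v y = 0 <-> C v y,
        forall v y, 0 <= phi v y, 0 < e
      & forall v w y, adj v w -> Y y -> phi v y <= e -> phi w y <= e -> False].
Proof.
move=> cY ZY [clC _ _ indC].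
have [phi phiP] := choice (fun v => closed_zero_set (clC v)).
have cphi v : continuous (phi v) by have [] := phiP v.
have phi_ge0 v y : 0 <= phi v y by have [] := phiP v.
have phi0 v y : phi v y = 0 <-> C v y by have [] := phiP v.
have [|vw|e e0 eP] := @fin_common_pos R (H * H)%type
  (fun vw e => forall y, adj vw.1 vw.2 -> Y y ->
     phi vw.1 y <= e -> phi vw.2 y <= e -> False).
- move=> vw e e' e'0 e'e eP y avw Yy ve we.
  by apply: (eP y) => //; apply: le_trans e'e.
- case: (boolP (adj vw.1 vw.2)) => [avw|navw]; last first.
    by exists 1 => // y; rewrite (negbTE navw).
  have [||e e0 eP] := @compact_pos_lb R _ Y (phi vw.1 \+ phi vw.2) cY.
  + apply: continuous_subspaceT => y.
    by apply: continuousD; exact: cphi.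
  + move=> y Yy /=; rewrite lt0r addr_ge0 // andbT paddr_eq0 //.
    by apply/negP => /andP[/eqP/phi0 Cv /eqP/phi0]; exact: indC Cv.
  exists (e / 3) => [|y _ Yy ve we]; first lra.
  have /= := eP y Yy; lra.
by exists phi, e; split=> // v w; exact: (eP (v, w)).
Qed.

(* Every point of [Y] goes to the nearest set of the cover of [Z], except that
   points far away from all of them go to the isolated vertex [x]. *)
Lemma cover_ext_cone (R : realType) (H : sgraph) (A : {set H}) (x : H)
    (k : nat) :
  x \in A -> (forall v, v \in A -> ~~ adj x v) -> cover_ext R A k.
Proof.
move=> xA isox n c Y Z C cY _ _ _ ZY covC.
have [phi [e [cphi phi0 phi_ge0 e0 phie]]] := indep_cover_sep cY ZY covC.
have [clC subC covZ indC] := covC.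
have clY : closed Y by apply: compact_closed => //; exact: norm_hausdorff.
(* A point of [Y] is in [D x] unless some [phi w] is smaller than both [phi x] and [e]. Non-strict
   inequalities keep all sets closed. *)
pose far w := [set y | phi x y <= phi w y] `|` [set y | e <= phi w y].
pose D v : set 'rV[R]_n := if v == x then Y `&` \bigcap_(w in [set` A]) far w
  else if v \in A then (Y `&` [set y | phi v y <= e]) `&`
    \bigcap_(w in [set` A]) [set y | phi v y <= phi w y]
  else set0.
have Dx y : D x y <-> Y y /\
    forall w, w \in A -> phi x y <= phi w y \/ e <= phi w y.
  by rewrite /D eqxx.
have DN v y : v != x -> D v y <-> [/\ v \in A, Y y, phi v y <= e &
    forall w, w \in A -> phi v y <= phi w y].
  move=> /negbTE vx; rewrite /D vx; case: ifP => vA; split=> //.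
  - by case=> [[Yy ve] vw]; split.
  - by case=> _ Yy ve vw; split.
  - by case.
exists D; last first.
  move=> v y Zy Dvy; have [u Cu] := covZ y Zy; have [uA _] := subC u y Cu.
  have phiu := (phi0 u y).2 Cu; apply/phi0/eqP; rewrite eq_le phi_ge0 andbT.
  have [vx|vx] := eqVneq v x.
    move: Dvy; rewrite vx => /Dx[_ /(_ u uA)]; rewrite phiu => -[//|].
    by rewrite leNgt e0.
  by move/DN: Dvy => /(_ vx)[_ _ _ /(_ u uA)]; rewrite phiu.
split.
- move=> v; rewrite /D; case: ifP => _.
    apply: closedI => //; apply: closed_bigI => w _.
    by apply: closedU; apply: closed_le_fun => //; exact: cst_continuous.
  case: ifP => _; last exact: closed0.
  apply: closedI; last by apply: closed_bigI => w _; exact: closed_le_fun.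
  by apply: closedI => //; apply: closed_le_fun => //; exact: cst_continuous.
- move=> v y; have [->|vx] := eqVneq v x; first by move=> /Dx[].
  by move=> /DN[].
- move=> y Yy; case: (arg_minP (fun v => phi v y) xA) => v vA vmin.
  have [vx|vx] := eqVneq v x.
    by exists x; apply/Dx; split=> // w wA; left; rewrite -vx; exact: vmin.
  have [ve|ev] := leP (phi v y) e; first by exists v; apply/DN.
  exists x; apply/Dx; split=> // w wA; right.
  by apply: le_trans (ltW ev) _; exact: vmin.
have DA v y : D v y -> v \in A.
  by have [->|vx] := eqVneq v x => // /DN[].
move=> v w y avw Dv Dw.
(* As [x] is isolated, two adjacent vertices both differ from [x]; then both values of [phi] are at
   most [e], against the choice of [e]. *)
have vx : v != x.
  by apply: contraTneq avw => ->; apply: isox; exact: DA Dw.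
have wx : w != x.
  by apply: contraTneq avw => ->; rewrite adj_sym; apply: isox; exact: DA Dv.
move/DN: Dv => /(_ vx)[_ Yy ve _]; move/DN: Dw => /(_ wx)[_ _ we _].
exact: phie avw Yy ve we.
Qed.

(** This is the cover to be extended over one side of the separating set [M]. Adjacent sets, one
    from [C] and one from [DM], cannot meet: they would meet in [Z], where [DM] refines [C]. *)
Lemma indep_cover_union (R : realType) (n : nat) (H : sgraph) (A A' : {set H})
    (Z Y M : set 'rV[R]_n) (C DM : H -> set 'rV[R]_n) :
  A' \subset A -> closed Y -> M `<=` Y -> indep_cover A' M DM ->
  (forall v y, Z y -> DM v y -> C v y) ->
  (forall v, closed (C v)) ->
  (forall v y, C v y -> Y y -> v \in A /\ Z y) ->
  (forall y, Z y -> exists v, C v y) ->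
  (forall v w y, adj v w -> C v y -> C w y -> False) ->
  indep_cover A ((Z `&` Y) `|` M) (fun v => (C v `&` Y) `|` DM v).
Proof.
move=> /fintype.subsetP sA clY MY [clD subD covM indD] DC clC subC covZ indC.
split=> [v|v y|y|v w y avw].
- by apply: closedU => //; exact: closedI.
- case=> [[Cv Yy]|/subD[vA My]].
    by have [] := subC v y Cv Yy; split=> //; left.
  by split; [exact: sA|right].
- case=> [[Zy Yy]|My].
    by have [v Cv] := covZ y Zy; exists v; left.
  by have [v Dv] := covM y My; exists v; right.
- case=> [[Cv Yy]|Dv] [[Cw Yy']|Dw].
  + exact: indC Cv Cw.
  + by have [_ Zy] := subC v y Cv Yy; apply: indC avw Cv _; exact: DC.
  + by have [_ Zy] := subC w y Cw Yy'; apply: indC avw _ Cw; exact: DC.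
  + exact: indD Dv Dw.
Qed.

(* [Y] is split along a set [M] of smaller dimension into a part that avoids
   the set of [x] and a part that avoids the sets of the neighbours of [x]. *)
Lemma cover_ext_glue (R : realType) (H : sgraph) (A : {set H}) (x : H)
    (k : nat) :
  x \in A -> cover_ext R (A :\ x) k.+1 ->
  cover_ext R (A :\: (x |: nbh x))%SET k -> cover_ext R A k.+1.
Proof.
move=> xA extd extl n c Y Z C cY thY nk clZ ZY [clC subC covZ indC].
(* This is the star of [x], used on [Y1], where no neighbour of [x] occurs. *)
have cone : cover_ext R (x |: A :\: nbh x)%SET k.+1.
  apply: (@cover_ext_cone R H _ x); first by rewrite !inE eqxx.
  move=> v; rewrite !inE => /orP[/eqP ->|/andP[]//].
  by rewrite adj_irr.
have [//|||||Y1 [Y2 [[cl1 cl2] YE P2 Q1 thM]]] :=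
  @thin_separation R n c Y (C x) (\bigcup_(w in [set` nbh x]) C w) cY.
- by apply: closed_bigcup => [|w _ //]; exact: finite_finset.
- by move=> y /subC[_ /ZY].
- by move=> y Cx [w]; rewrite /= inE => axw; exact: indC Cx.
- exact: thY.
have Y1Y : Y1 `<=` Y by rewrite YE => y; left.
have Y2Y : Y2 `<=` Y by rewrite YE => y; right.
pose M := Y1 `&` Y2.
have M1 : M `<=` Y1 by move=> y [].
have M2 : M `<=` Y2 by move=> y [].
have clM : closed M by exact: closedI.
have cC1 v y : C v y -> Y1 y -> v \notin nbh x.
  by move=> Cv Yy; apply/negP => vx; apply: (Q1 y) => //; exists v.
have cC2 v y : C v y -> Y2 y -> v != x.
  by move=> Cv Yy; apply: contra_notN (P2 y ^~ Yy) => /eqP <-.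
(* On [M] neither [x] nor a neighbour of [x] occurs, so [C] restricts to a cover by link vertices.
   The drop from [k.+1] to [k] is paid for by the thinness [c.+1] of [M]. *)
have [| | | | | |DM covM DMC] := extl n c.+1 M (Z `&` M) (fun v => C v `&` M).
- by apply: subclosed_compact clM cY _ => y /M1/Y1Y.
- exact: thM.
- by rewrite addSnnS.
- exact: closedI.
- by move=> y [].
- split=> [v|v y [Cv My]|y [Zy My]|v w y avw [Cv _] [Cw _]].
  + exact: closedI.
  + have [vA Zy] := subC v y Cv; split=> //.
    have := cC1 v y Cv (M1 y My); have := cC2 v y Cv (M2 y My).
    by rewrite !inE vA andbT negb_or => -> ->.
  + by have [v Cv] := covZ y Zy; exists v.
  + exact: indC Cv Cw.
have subM v y : DM v y -> M y by case: covM => _ + _ _ => /(_ v y) sM /sM[].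
have {}DMC v y : Z y -> DM v y -> C v y.
  by move=> Zy Dv; have [] := DMC v y (conj Zy (subM v y Dv)) Dv.
have ext Y' A' : cover_ext R A' k.+1 -> Y' `<=` Y -> closed Y' -> M `<=` Y' ->
    (A :\: (x |: nbh x) \subset A')%SET ->
    (forall v y, C v y -> Y' y -> v \in A') ->
    exists2 D, indep_cover A' Y' D &
      forall v y, ((Z `&` Y') `|` M) y -> D v y -> ((C v `&` Y') `|` DM v) y.
  move=> extA Y'Y clY' MY' sA CA'; apply: (extA n c) => //.
  - exact: subclosed_compact clY' cY _.
  - by case: thY => T thT; exists T => y /Y'Y/thT.
  - by apply: closedU => //; exact: closedI.
  - by move=> y [[]//|/MY'].
  - apply: (indep_cover_union (A' := A :\: (x |: nbh x))%SET) => //.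
    by move=> v y Cv Yy; split; [exact: CA' Cv Yy|have [] := subC v y Cv].
have [|v y Cv Yy|D1 [clD1 subD1 covD1 indD1] DC1] := ext Y1 _ cone Y1Y cl1 M1.
- apply/fintype.subsetP => v; rewrite !inE negb_or.
  by case: (v == x); case: (adj x v).
- by have := cC1 v y Cv Yy; rewrite !inE (subC v y Cv).1 => ->; rewrite orbT.
have [|v y Cv Yy|D2 [clD2 subD2 covD2 indD2] DC2] := ext Y2 _ extd Y2Y cl2 M2.
- apply/fintype.subsetP => v; rewrite !inE negb_or.
  by case: (v == x); case: (adj x v).
- by rewrite !inE (subC v y Cv).1 (cC2 v y Cv Yy).
(* Sets from different sides meet only in [M], where both covers refine the union of [C] and [DM],
   which is independent. *)
have cross v w y : adj v w -> D1 v y -> D2 w y -> False.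
  move=> avw D1v D2w.
  have My : M y by have [_] := subD1 v y D1v; have [_] := subD2 w y D2w.
  have C1 := DC1 v y (or_intror My) D1v; have C2 := DC2 w y (or_intror My) D2w.
  have [_ subDM _ indDM] := covM.
  case: C1 C2 => [[Cv _]|Dv] [[Cw _]|Dw].
  - exact: indC Cv Cw.
  - by apply: (indC v w y) => //; apply: DMC => //; have [] := subC v y Cv.
  - by apply: (indC v w y) => //; apply: DMC => //; have [] := subC w y Cw.
  - exact: indDM Dv Dw.
exists (fun v => D1 v `|` D2 v); last first.
  move=> v y Zy [D1v|D2v].
    have [_ Yy] := subD1 v y D1v.
    by case: (DC1 v y (or_introl (conj Zy Yy)) D1v) => [[]//|]; exact: DMC.
  have [_ Yy] := subD2 v y D2v.
  by case: (DC2 v y (or_introl (conj Zy Yy)) D2v) => [[]//|]; exact: DMC.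
split=> [v|v y|y|v w y avw].
- exact: closedU.
- case=> [/subD1[+ /Y1Y]|/subD2[+ /Y2Y]]; rewrite !inE.
    by case/orP=> [/eqP ->|/andP[]].
  by case/andP.
- by rewrite YE => -[/covD1|/covD2] [v Dv]; exists v; [left|right].
- case=> [D1v|D2v] [D1w|D2w].
  + exact: indD1 D1v D1w.
  + exact: cross D1v D2w.
  + by apply: cross D1w D2v; rewrite adj_sym.
  + exact: indD2 D2v D2w.
Qed.

(** * Squids *)

(** [cover_ext_glue] removes the vertices of [X] one at a time; [X'] consists of those already gone
    when the link of [x] is taken. *)
Lemma cover_ext_remove (R : realType) (H : sgraph) (A X : {set H}) (k : nat) :
  X \subset A -> cover_ext R (A :\: X)%SET k.+1 ->
  (forall (X' : {set H}) x, X' \subset X -> x \in X -> x \notin X' ->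
     cover_ext R ((A :\: X') :\: (x |: nbh x))%SET k) ->
  cover_ext R A k.+1.
Proof.
move=> XA extAX link.
suff ext n (X' : {set H}) : X' \subset X -> #|(X :\: X')%SET| = n ->
    cover_ext R (A :\: X')%SET k.+1.
  rewrite -(finset.setD0 A); apply: (ext _ finset.set0) => //.
  exact: finset.sub0set.
elim: n X' => [|n IH] X' X'X cardX.
  suff -> : X' = X by [].
  apply/eqP; rewrite finset.eqEsubset X'X /= -finset.setD_eq0.
  by rewrite -cards_eq0 cardX.
have /card_gt0P[x xX] : (0 < #|(X :\: X')%SET|)%N by rewrite cardX.
move: (xX); rewrite inE => /andP[xX' xX1].
apply: (@cover_ext_glue R H _ x).
- by rewrite inE xX' (fintype.subsetP XA).
- rewrite finset.setDDl finset.setUC; apply: IH.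
    by rewrite finset.subUset finset.sub1set xX1.
  move: cardX; rewrite (cardsD1 x) xX add1n => -[<-].
  by rewrite finset.setDDl finset.setUC.
- exact: link.
Qed.

Lemma is_squid_fill (G : sgraph) (q : nat) (w : G)
    (S : {set cart G (complete q)}) :
  is_squid w S -> is_squid w (S :|: finset.setX [set w] [set: 'I_q])%SET.
Proof.
move=> [[v [i [avw sS]]]|[i [j [ij sS]]]].
  left; exists v, i; split=> //.
  by rewrite finset.subUset sS finset.subsetUr.
right; exists i, j; split=> //.
by rewrite finset.subUset sS finset.subsetUr.
Qed.

(** Indexing the squids by their bodies makes the bodies pairwise different. *)
Definition squid_union (G : sgraph) (q : nat) (B : {set G})
    (U : {set cart G (complete q)}) : Prop :=
  exists2 S : G -> {set cart G (complete q)},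
    forall b, b \in B -> is_squid b (S b) & U = (\bigcup_(b in B) S b)%SET.

(** A link taken at a vertex over an existing body [v] loses the whole column of [v]; the squid of
    [v] absorbs it. *)
Lemma squid_union_fill (G : sgraph) (q : nat) (B : {set G})
    (U : {set cart G (complete q)}) (v : G) :
  v \in B -> squid_union B U ->
  squid_union B (U :|: finset.setX [set v] [set: 'I_q])%SET.
Proof.
move=> vB [S sqS ->].
exists (fun b => if b == v then S b :|: finset.setX [set b] [set: 'I_q]
                 else S b)%SET.
  move=> b bB; case: eqP => _; last exact: sqS.
  exact: is_squid_fill (sqS b bB).
rewrite (bigD1 v) //= [in RHS](bigD1 v) //= eqxx -!finset.setUA.
congr (_ :|: _)%SET.
rewrite finset.setUC; congr (_ :|: _)%SET.
by apply: eq_bigr => b /andP[_ /negbTE ->].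
Qed.

Lemma squid_union_add (G : sgraph) (q : nat) (B : {set G})
    (U T : {set cart G (complete q)}) (v : G) :
  v \notin B -> is_squid v T -> squid_union B U ->
  squid_union (v |: B)%SET (U :|: T)%SET.
Proof.
move=> vB sqT [S sqS ->].
exists (fun b => if b == v then T else S b).
  by move=> b; rewrite !inE; case: eqP => [->|_] //=; exact: sqS.
rewrite big_setU1 //= eqxx finset.setUC; congr (_ :|: _)%SET.
by apply: eq_bigr => b bB; case: eqP => // bv; rewrite -bv bB in vB.
Qed.

(** Off the column of its body [w], a squid of the first kind uses one colour, over vertices
    adjacent to [w] or reached from [w] through [v]; one of the second kind uses two colours, over
    neighbours of [w] only. *)
Lemma squid_colours (G : sgraph) (q : nat) (w u : G)
    (S : {set cart G (complete q)}) :
  w != u -> is_squid w S ->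
  (#|[set c : 'I_q | (u, c) \in S]%SET| <=
     (w \in nbh2 u) + 2 * (w \in nbh u))%N.
Proof.
move=> wu; have uw : (u == w) = false by rewrite eq_sym (negbTE wu).
case=> [[v [i [avw /fintype.subsetP sS]]]|[i [j [_ /fintype.subsetP sS]]]].
  have [[c cS]|nS] := pselect (exists c, (u, c) \in S); last first.
    rewrite (_ : [set c | _]%SET = finset.set0) ?cards0 //.
    apply/finset.setP => c; rewrite !inE; apply/negP => cS.
    by apply: nS; exists c.
  have le1 : (#|[set c : 'I_q | (u, c) \in S]%SET| <= 1)%N.
    rewrite -(cards1 i); apply/subset_leq_card/fintype.subsetP => c'.
    by rewrite inE => /sS; rewrite !inE /= uw /= orbF => /andP[].
  apply: leq_trans le1 _; have := sS _ cS.
  rewrite !inE /= uw /= orbF => /andP[+ _].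
  have [|nuw] := boolP (adj u w); first by rewrite addnC.
  rewrite (adj_sym w u) (negbTE nuw) orbF => avu /=.
  suff -> : w \in (\bigcup_(x in nbh u) nbh x)%SET by rewrite wu.
  by apply/finset.bigcupP; exists v; rewrite inE // adj_sym.
have [auw|nuw] := boolP (w \in nbh u).
  apply: (@leq_trans #|[set i; j]%SET|); last first.
    by rewrite cards2; case: (_ != _); case: (_ \in _).
  apply/subset_leq_card/fintype.subsetP => c.
  by rewrite inE => /sS; rewrite !inE /= uw /= orbF => /andP[].
rewrite (_ : [set c | _]%SET = finset.set0) ?cards0 //.
apply/finset.setP => c; rewrite !inE; apply/negP => /sS.
rewrite !inE /= uw /= orbF => /andP[+ _].
by rewrite adj_sym => awu; rewrite inE awu in nuw.
Qed.

(** Summing [squid_colours] over the bodies bounds the number of colours lost at [u]. *)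
Lemma squid_union_free (G : sgraph) (q : nat) (B : {set G})
    (U : {set cart G (complete q)}) (u : G) :
  u \notin B -> squid_union B U -> (#|nbh2 u| + 2 * #|nbh u| < q)%N ->
  exists c : 'I_q, (u, c) \notin U.
Proof.
move=> uB [S sqS ->] ltq.
pose F (b : G) := [set c : 'I_q | (u, c) \in S b]%SET.
have le : (#|(\bigcup_(b in B) F b)%SET| <= #|nbh2 u| + 2 * #|nbh u|)%N.
  apply: (@leq_trans (\sum_(b in B) #|F b|)%N).
    elim/big_rec2: _ => [|b n K _ leK]; first by rewrite cards0.
    by apply: leq_trans (leq_card_setU _ _) _; rewrite leq_add2l.
  apply: (@leq_trans (\sum_(b in B) ((b \in nbh2 u) + 2 * (b \in nbh u)))%N).
    apply: leq_sum => b bB; apply: squid_colours; last exact: sqS.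
    by apply: contraNneq uB => <-.
  apply: (@leq_trans (\sum_b ((b \in nbh2 u) + 2 * (b \in nbh u)))%N).
    by rewrite [leqRHS](bigID (mem B)) /= leq_addr.
  have cnt (X : {set G}) : (\sum_b (b \in X))%N = #|X|.
    by rewrite -sum1_card [RHS]big_mkcond.
  by rewrite big_split /= -big_distrr /= !cnt.
have [c] : exists c, c \notin (\bigcup_(b in B) F b)%SET.
  apply/existsP; rewrite -negb_forall; apply/negP => /forallP all.
  have : (#|[set: 'I_q]%SET| <= #|(\bigcup_(b in B) F b)%SET|)%N.
    by apply/subset_leq_card/fintype.subsetP => c _; exact: all.
  rewrite cardsT card_ord => qle.
  by have := leq_trans ltq (leq_trans qle le); rewrite ltnn.
move=> nc; exists c; apply: contra nc => /finset.bigcupP[b bB cS].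
by apply/finset.bigcupP; exists b; rewrite ?inE.
Qed.

Lemma closed_nbh_cart (G : sgraph) (q : nat) (v : G) (c : 'I_q) :
  ((v, c) |: nbh ((v, c) : cart G (complete q)))%SET =
  (finset.setX [set v] [set: 'I_q] :|: finset.setX (nbh v) [set c])%SET.
Proof.
apply/finset.setP => -[w d]; rewrite !inE /= /cart_adj /= xpair_eqE.
rewrite [d == c]eq_sym [w == v]eq_sym.
by case: eqP => [->|_]; case: eqP => _;
  rewrite ?adj_irr ?andbT ?andbF ?orbT ?orbF.
Qed.

Lemma cover_ext_squids (R : realType) (G : sgraph) (q : nat) :
  (forall v : G, (#|nbh2 v| + 2 * #|nbh v| < q)%N) ->
  forall (k : nat) (B : {set G}) (U : {set cart G (complete q)}),
  squid_union B U -> (k + #|B| = #|G|)%N -> cover_ext R (~: U)%SET k.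
Proof.
move=> ltq; elim=> [|k IH] B U sqU cardB; first exact: cover_ext0.
have [u uB] : exists u, u \notin B.
  apply/existsP; rewrite -negb_forall; apply/negP => /forallP all.
  have : (#|[set: G]%SET| <= #|B|)%N.
    by apply/subset_leq_card/fintype.subsetP => v _; exact: all.
  by rewrite cardsT -cardB addSn ltnNge leq_addl.
have [c cU] := squid_union_free uB sqU (ltq u).
(* Every link below is the complement of squids with one more body, so the induction hypothesis
   applies to it. *)
have step (U' : {set cart G (complete q)}) v :
    v \notin B -> squid_union (v |: B)%SET U' -> cover_ext R (~: U')%SET k.
  by move=> vB sqU'; apply: IH sqU' _; rewrite cardsU1 vB add1n addnS -addSn.
set A := (~: U)%SET.
pose X := (finset.setX (nbh u) [set c] :&: A)%SET : {set cart G (complete q)}.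
pose X2 := ((finset.setX [set u] [set: 'I_q] :\ (u, c)) :&: A)%SET
  : {set cart G (complete q)}.
have XP x : x \in X -> [/\ adj u x.1, x.2 = c & x \in A].
  by rewrite !inE => /andP[/andP[-> /eqP ->] ->].
have X2P x : x \in X2 -> [/\ x.1 = u, x.2 != c & x \in A].
  case: x => v d; rewrite !inE /= xpair_eqE.
  move=> /andP[/andP[+ /andP[/eqP vu _]] ->].
  by rewrite vu eqxx.
apply: (@cover_ext_remove R _ A X); first exact: finset.subsetIr.
  apply: (@cover_ext_remove R _ (A :\: X)%SET X2).
  - apply/fintype.subsetP => x /X2P[xu _ xA]; rewrite inE xA andbT.
    by apply/negP => /XP[]; rewrite xu adj_irr.
  (* All neighbours of [(u, c)], in the copy of [G] of colour [c] and in the column of [u], are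
     gone. *)
  - apply: (@cover_ext_cone R (cart G (complete q)) _ (u, c)).
      by rewrite !inE /= !eqxx adj_irr /= cU.
    move=> [v d]; rewrite !inE /= xpair_eqE /cart_adj /= => /and3P[].
    rewrite [d == c]eq_sym [v == u]eq_sym.
    by case: eqP => [<-|_]; case: eqP => [<-|_] /=; rewrite ?adj_irr ?andbT //=;
      case: (_ \in U) => //=; case: (adj _ _).
  (* In the link of [(u, d)] everything newly removed lies in a squid of the second kind with body
     [u] and colours [c], [d]. *)
  move=> X' x /fintype.subsetP X'X2 xX2 xX'.
  have {xX2}[xu xc _] := X2P x xX2.
  case: x xu xc xX' => [v d] /= -> dc _.
  pose N := ((u, d) |: nbh ((u, d) : cart G (complete q)))%SET.
  rewrite -/N; have -> : ((A :\: X) :\: X' :\: N =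
      ~: (U :|: (X :|: X' :|: N)))%SET.
    by rewrite !finset.setDDl finset.setDE -finset.setCU -!finset.setUA.
  apply: (step _ u) => //.
  apply: squid_union_add => //; right.
  have sub : (X :|: X' :|: N \subset
      finset.setX (nbh u) [set c; d] :|: finset.setX [set u] [set: 'I_q])%SET.
    rewrite /N closed_nbh_cart; apply/fintype.subsetP => -[w e].
    move=> /finset.setUP[/finset.setUP[/XP|/X'X2/X2P]|].
    - by rewrite /= => -[awu -> _]; rewrite !inE /= awu eqxx.
    - by rewrite /= => -[-> _ _]; rewrite !inE /= eqxx orbT.
    - by rewrite !inE /= => /orP[->|/andP[-> ->]]; rewrite !orbT.
  have [cd|dc'|/val_inj dcE] := ltngtP c d.
  - by exists c, d.
  - by exists d, c; split=> //; rewrite [[set d; c]%SET]finset.setUC.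
  - by rewrite dcE eqxx in dc.
move=> X' x /fintype.subsetP X'X xX xX'.
have {xX}[+ + _] := XP x xX.
case: x xX' => [v d] /= _ auv ->.
(* For the link of [(v, c)]: if [v] is not yet a body, the newly removed vertices form a squid of
   the first kind with body [v] and neighbour [u]. *)
case: (boolP (v \in B)) => vB; last first.
  have -> : (A :\: X' :\: ((v, c) |: nbh ((v, c) : cart G (complete q))) =
      ~: (U :|: (X' :|: ((v, c) |: nbh ((v, c) : cart G (complete q))))))%SET.
    by rewrite !finset.setDDl finset.setDE -finset.setCU.
  apply: (step _ v) => //.
  apply: squid_union_add => //; left; exists u, c; split=> //.
  rewrite closed_nbh_cart; apply/fintype.subsetP => -[w e].
  move=> /finset.setUP[/X'X/XP|].
    by rewrite /= => -[awu -> _]; rewrite !inE /= awu eqxx.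
  by rewrite !inE /= => /orP[->|/andP[-> ->]]; rewrite !orbT.
(* If [v] is already a body, its squid takes the column of [v], and the rest is a squid of the first
   kind with the new body [u] and neighbour [v]. *)
have -> : (A :\: X' :\: ((v, c) |: nbh ((v, c) : cart G (complete q))) =
    ~: ((U :|: finset.setX [set v] [set: 'I_q]) :|:
        (X' :|: finset.setX (nbh v) [set c])))%SET.
  rewrite !finset.setDDl finset.setDE -finset.setCU closed_nbh_cart.
  congr (~: _)%SET; rewrite -!finset.setUA; congr (_ :|: _)%SET.
  by rewrite finset.setUCA.
apply: (step _ u) => //.
apply: squid_union_add => //; last exact: squid_union_fill.
left; exists v, c; split; first by rewrite adj_sym.
apply/fintype.subsetP => -[w e] /finset.setUP[/X'X/XP|].
  by rewrite /= => -[awu -> _]; rewrite !inE /= awu eqxx orbT.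
by rewrite !inE /= => /andP[-> ->].
Qed.

(** * From covers to connectedness *)

Lemma within_continuous_coord (R : realType) (T : topologicalType) (V : finType)
    (A : set T) (g : T -> {ptws V -> R}) :
  {within A, continuous g} <->
  forall v, {within A, continuous (fun t => g t v)}.
Proof.
split=> [cg v t|cg t].
  exact: (continuous_comp (cg t) (@proj_continuous V (fun=> R) v (g t))).
apply/cvg_sup => v B [O [[W oW WO] Ogt OB]].
apply: (filterS OB); rewrite -WO; apply: cg.
by apply: open_nbhs_nbhs; split=> //; rewrite -WO in Ogt.
Qed.

Lemma within_continuous_compose (T1 T2 T3 : topologicalType) (A : set T1)
    (B : set T2) (u : T1 -> T2) (g : T2 -> T3) :
  {within A, continuous u} -> (forall t, A t -> B (u t)) ->
  {within B, continuous g} -> {within A, continuous (g \o u)}.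
Proof.
move=> /subspace_continuousP cu AB /subspace_continuousP cg.
apply/subspace_continuousP => t At W /(cg _ (AB t At)) BW.
have nW : nbhs t [set s | A s -> B (u s) -> W (g (u s))].
  exact: (cu t At _ BW).
by apply: (@filterS _ (nbhs t)) nW => s + As; apply => //; exact: AB.
Qed.

Lemma within_closed_preimage (R : realType) (T : topologicalType) (A : set T)
    (g : T -> R) (D : set R) :
  closed A -> {within A, continuous g} -> closed D -> closed (A `&` g @^-1` D).
Proof.
move=> clA /continuous_closedP cg clD.
have /closed_subspaceP[W clW WE] := cg D clD.
have -> : A `&` g @^-1` D = W `&` A by rewrite setIC -[LHS]WE.
exact: closedI.
Qed.

Definition enorm (R : realType) (n : nat) (y : 'rV[R]_n) : R :=
  Num.sqrt (\sum_(j < n) y 0 j ^+ 2).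

Lemma enorm_continuous (R : realType) (n : nat) : continuous (@enorm R n).
Proof.
move=> y; apply: continuous_comp; last exact: sqrt_continuous.
apply: continuous_big => [|j _ z]; first exact: add_continuous.
apply: (@continuous_comp _ _ _ (fun x : 'rV[R]_n => x 0 j) (fun r => r ^+ 2)).
  exact: coord_continuous.
exact: exprn_continuous.
Qed.

Lemma enorm_ge0 (R : realType) (n : nat) (y : 'rV[R]_n) : 0 <= enorm y.
Proof. exact: sqrtr_ge0. Qed.

Lemma enorm_sqr (R : realType) (n : nat) (y : 'rV[R]_n) :
  enorm y ^+ 2 = \sum_(j < n) y 0 j ^+ 2.
Proof. by rewrite sqr_sqrtr //; apply: sumr_ge0 => j _; exact: sqr_ge0. Qed.

Lemma diskP (R : realType) (n : nat) (y : 'rV[R]_n) : disk y <-> enorm y <= 1.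
Proof.
rewrite /disk /= -enorm_sqr expr_le1 ?enorm_ge0 //.
Qed.

Lemma sphereP (R : realType) (n : nat) (y : 'rV[R]_n.+1) :
  sphere y <-> enorm y = 1.
Proof.
rewrite /sphere /= -enorm_sqr; split=> [/eqP|->]; last by rewrite expr1n.
rewrite sqrf_eq1 => /orP[/eqP //|/eqP y1].
by have := enorm_ge0 y; rewrite y1 ler0N1.
Qed.

Lemma enormZ (R : realType) (n : nat) (a : R) (y : 'rV[R]_n) :
  0 <= a -> enorm (a *: y) = a * enorm y.
Proof.
move=> a0; rewrite /enorm -{2}(ger0_norm a0) -sqrtr_sqr -sqrtrM ?sqr_ge0 //.
by rewrite mulr_sumr; congr Num.sqrt; apply: eq_bigr => j _; rewrite mxE exprMn.
Qed.

Lemma disk_compact (R : realType) (n : nat) : compact (@disk R n).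
Proof.
apply: bounded_closed_compact.
  exists 1; split=> [|M M1 y]; first exact: num_real.
  rewrite /disk /= => y1; apply: le_trans (ltW M1).
  have yE : `|y| = mx_norm y by [].
  have [y0|/mx_norm_neq0[[i j] /= ij]] := eqVneq (mx_norm y) 0.
    by rewrite yE y0.
  rewrite yE ij ord1 -(@expr_le1 _ 2) // real_normK ?num_real //.
  apply: le_trans y1; rewrite (bigD1 j) //= lerDl sumr_ge0 // => l _.
  exact: sqr_ge0.
have -> : @disk R n = [set y | enorm y <= 1] by apply/seteqP; split=> y /diskP.
by apply: closed_le_fun; [exact: enorm_continuous|exact: cst_continuous].
Qed.

Lemma radial_continuous (R : realType) (n : nat) (A : set 'rV[R]_n) :
  (forall y, A y -> enorm y != 0) ->
  {within A, continuous (fun y : 'rV[R]_n => (enorm y)^-1 *: y)}.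
Proof.
move=> A0; apply: continuous_in_subspaceT => y /set_mem Ay.
apply: (@continuousZ R _ _ (fun y : 'rV[R]_n => (enorm y)^-1) id y).
  by apply: continuousV; [exact: A0|exact: enorm_continuous].
exact: cvg_id.
Qed.

Lemma realization_IndP (R : realType) (K : sgraph) (x : {ptws K -> R}) :
  realization (Ind K) x <->
  [/\ forall v, 0 <= x v, \sum_v x v = 1
    & forall u v, adj u v -> x u != 0 -> x v != 0 -> False].
Proof.
split=> -[x0 x1 xK]; split=> //.
  move=> u v auv xu xv; move: xK; rewrite inE => /forall_inP /(_ u).
  by rewrite inE => /(_ xu) /forall_inP /(_ v); rewrite inE auv => /(_ xv).
rewrite inE; apply/forall_inP => u; rewrite inE => xu.
apply/forall_inP => v; rewrite inE => xv.
by apply/negP => auv; exact: xK auv xu xv.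
Qed.

(** Some coordinate is at least the average. Hence the closed sets on which a given barycentric
    coordinate has at least this value form a cover. *)
Lemma exists_large_coord (R : realType) (V : finType) (x : V -> R) :
  \sum_v x v = 1 -> exists v, #|V|%:R^-1 <= x v.
Proof.
move=> x1; apply: contrapT => nx.
have lt v : x v < #|V|%:R^-1.
  by rewrite ltNge; apply/negP => ge; apply: nx; exists v.
have [V0|V0] := posnP #|V|.
  have := x1; rewrite big1 => [/eqP|v _]; first by rewrite eq_sym oner_eq0.
  by have := fintype0 v V0.
have [v0 _] := card_gt0P V0.
have : \sum_v x v < \sum_(v : V) #|V|%:R^-1.
  by apply: ltr_sum => //; apply/hasP; exists v0; rewrite ?mem_index_enum.
by rewrite x1 sumr_const -[_ *+ _]mulr_natl divff ?ltxx // pnatr_eq0 -lt0n.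
Qed.

(* The partition of unity [p] attached to the cover of the disk is glued to [f]
   along the annulus [1/2 <= |y| <= 1], where the support of [p] lies in the
   support of the radial extension [F] of [f]. *)
Lemma cover_ext_disk (R : realType) (H : sgraph) (U : {set H}) (k i : nat)
    (f : 'rV[R]_i.+1 -> {ptws delete U -> R}) :
  cover_ext R (~: U)%SET k -> (i.+1 < k)%N ->
  {within @sphere R i, continuous f} ->
  (forall y, sphere y -> realization (Ind (delete U)) (f y)) ->
  exists g : 'rV[R]_i.+1 -> {ptws delete U -> R},
    [/\ {within @disk R i.+1, continuous g},
        forall y, disk y -> realization (Ind (delete U)) (g y)
      & forall y, sphere y -> f y = g y].
Proof.
move=> ext ik cf fK.
(* The annulus stays away from the origin, so the radial extension [F] is continuous on it. *)
pose Z := [set y : 'rV[R]_i.+1 | 2^-1 <= enorm y] `&` @disk R i.+1.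
pose F (y : 'rV[R]_i.+1) := f ((enorm y)^-1 *: y).
have cN := @enorm_continuous R i.+1.
have Z0 y : Z y -> enorm y != 0.
  move=> [/= ge _]; rewrite gt_eqF //; apply: lt_le_trans ge.
  by rewrite invr_gt0.
have ZS y : Z y -> sphere ((enorm y)^-1 *: y).
  move=> /Z0 y0; apply/sphereP.
  by rewrite enormZ ?invr_ge0 ?enorm_ge0 // mulVf.
have FK y : Z y -> realization (Ind (delete U)) (F y) by move=> /ZS/fK.
have cD := @disk_compact R i.+1.
have clD : closed (@disk R i.+1).
  by apply: compact_closed => //; exact: norm_hausdorff.
have clZ : closed Z.
  by apply: closedI => //; apply: closed_le_fun => //; exact: cst_continuous.
have ZD : Z `<=` @disk R i.+1 by move=> y [].
have cZ : compact Z by exact: subclosed_compact clZ cD ZD.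
have cF v : {within Z, continuous (fun y => F y v)}.
  have cfv : {within @sphere R i, continuous (fun y => f y v)}.
    by move/within_continuous_coord: cf; exact.
  exact: (within_continuous_compose (radial_continuous Z0) ZS cfv).
pose a : R := #|delete U|%:R^-1.
(* The union has at most one term, and none if [v] lies in [U]. *)
pose C (v : H) := \bigcup_(x in [set x : delete U | val x = v])
  (Z `&` (fun y => F y x) @^-1` [set r | a <= r]).
have a_gt0 (x : delete U) : 0 < a.
  by rewrite invr_gt0 ltr0n; apply/card_gt0P; exists x.
have covC : indep_cover (~: U)%SET Z C.
  split.
  - move=> v; apply: closed_bigcup => [|x _]; first exact: finite_finset.
    by apply: within_closed_preimage => //; exact: closed_ge.
  - by move=> v y [x /= <- [Zy _]]; rewrite inE (valP x).
  - move=> y Zy; have [_ /exists_large_coord[x xa] _] := FK y Zy.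
    by exists (val x), x.
  - move=> v w y avw [x /= xv [Zy ax]] [x' /= x'w [_ ax']].
    have /realization_IndP[_ _ indF] := FK y Zy.
    apply: (indF x x'); rewrite /= ?xv ?x'w //.
      by rewrite gt_eqF // (lt_le_trans (a_gt0 x)).
    by rewrite gt_eqF // (lt_le_trans (a_gt0 x)).
have [D covD DC] := ext i.+1 0%N (@disk R i.+1) Z C cD (thin0 _) ik clZ ZD covC.
have [phi [e0 [cphi phi0 phi_ge0 e0_gt0 phie0]]] :=
  indep_cover_sep cD (fun=> id) covD.
have [clDv subD covDv indD] := covD.
(* On [Z] the set [D (val x)] lies where [F y x] is at least [a], hence away from the zeros of
   [F y x]; [e1] bounds [phi (val x)] from below at these zeros. *)
have [|x|e1 e1_gt0 phie1] := @fin_common_pos R (delete U)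
  (fun x e => forall y, Z y -> F y x = 0 -> e <= phi (val x) y).
- by move=> x e e' _ e'e xe y Zy Fy; apply: le_trans e'e _; exact: xe.
- have [|||e e_gt0 eP] := @compact_pos_lb R _
      (Z `&` (fun y => F y x) @^-1` [set 0]) (phi (val x)).
  + apply: subclosed_compact cZ _; last by move=> y [].
    by apply: within_closed_preimage => //; exact: closed_eq.
  + exact: continuous_subspaceT.
  + move=> y [Zy /= Fy]; rewrite lt0r phi_ge0 andbT; apply/eqP => /phi0 Dy.
    have [x' /val_inj -> [_ /=]] := DC _ _ Zy Dy.
    by rewrite Fy leNgt (a_gt0 x).
  by exists e => // y Zy Fy; exact: eP.
pose e := Num.min e0 e1.
have e_gt0 : 0 < e by rewrite lt_min e0_gt0.
(* The tents [h x] are supported where [phi (val x)] is below [e]: [e0] makes the support of [p y]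
   independent, and [e1] puts it inside that of [F y] on [Z]. *)
pose h (x : delete U) y := Num.max 0 (e - phi (val x) y).
pose s y := \sum_x h x y.
pose p y (x : delete U) := h x y / s y.
have h_ge0 x y : 0 <= h x y by rewrite le_max lexx.
have h_neq0 x y : h x y != 0 -> phi (val x) y < e.
  rewrite /h; have [le0|lt0] := leP (e - phi (val x) y) 0.
    by rewrite eqxx.
  by rewrite -subr_gt0.
have s_gt0 y : disk y -> 0 < s y.
  move=> /covDv[v Dv]; have [vU _] := subD v y Dv; rewrite inE in vU.
  apply: (@lt_le_trans _ _ (h (Sub v vU) y)).
    by rewrite lt_max /= ((phi0 v y).2 Dv) subr0 e_gt0 orbT.
  by rewrite /s (bigD1 (Sub v vU)) //= lerDl sumr_ge0.
have ch x : continuous (h x).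
  move=> y; apply: (@continuous_max _ _ (fun=> 0) (fun y => e - phi (val x) y)).
    exact: cst_continuous.
  apply: (@continuousB _ _ _ (fun=> e) (phi (val x))).
    exact: cst_continuous.
  exact: cphi.
have cs : continuous s.
  by apply: continuous_big => [|x _]; [exact: add_continuous|exact: ch].
have cp x : {within @disk R i.+1, continuous (fun y => p y x)}.
  apply: continuous_in_subspaceT => y /set_mem Dy.
  apply: (@continuousM _ _ (h x) (fun y => (s y)^-1)); first exact: ch.
  by apply: continuousV; [rewrite gt_eqF // s_gt0|exact: cs].
have pK y : disk y -> realization (Ind (delete U)) (p y).
  move=> Dy; have s0 := s_gt0 y Dy; apply/realization_IndP; split.
  - by move=> x; rewrite divr_ge0 // ltW.
  - by rewrite -mulr_suml divff // gt_eqF.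
  - move=> u v auv; rewrite !mulf_eq0 !negb_or.
    move=> /andP[/h_neq0 ue _] /andP[/h_neq0 ve _].
    have ee0 : e <= e0 by rewrite ge_min lexx.
    by apply: (phie0 (val u) (val v) y) => //; apply: le_trans ee0; exact: ltW.
have pF y x : Z y -> p y x != 0 -> F y x != 0.
  move=> Zy; rewrite mulf_eq0 negb_or => /andP[/h_neq0 lt _].
  apply: contraL lt => /eqP Fy; rewrite -leNgt.
  apply: le_trans (phie1 x y Zy Fy).
  by rewrite ge_min lexx orbT.
(* The weight [l] is 0 up to radius 1/2 and grows linearly to 1 on the sphere. *)
pose l (y : 'rV[R]_i.+1) := Num.max 0 (2 * enorm y - 1).
have cl : continuous l.
  move=> y; apply: (@continuous_max _ _ (fun=> 0) (fun y => 2 * enorm y - 1)).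
    exact: cst_continuous.
  apply: (@continuousB _ _ _ (fun y => 2 * enorm y) (fun=> 1)).
    apply: (@continuousM _ _ (fun=> 2) (@enorm R i.+1)); last exact: cN.
    exact: cst_continuous.
  exact: cst_continuous.
have l_ge0 y : 0 <= l y by rewrite le_max lexx.
have l_le1 y : disk y -> l y <= 1.
  by move=> /diskP y1; rewrite ge_max ler01 /=; clear -y1; lra.
have l_small y : enorm y <= 2^-1 -> l y = 0.
  by move=> y2; rewrite /l; apply: max_l; clear -y2; lra.
pose g y (x : delete U) := l y * F y x + (1 - l y) * p y x.
have gp y : l y = 0 -> g y = p y.
  by move=> ly; apply/funext => x; rewrite /g ly mul0r add0r subr0 mul1r.
exists g; split.
- apply/within_continuous_coord => x.
  pose N := [set y : 'rV[R]_i.+1 | enorm y <= 2^-1] `&` @disk R i.+1.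
  (* Continuity is checked on two closed pieces: on [N] the map is [p], and on [Z] also [F] is
     continuous. *)
  have -> : @disk R i.+1 = N `|` Z.
    rewrite /N /Z -setIUl; apply/esym/setIidPr => y _ /=.
    by apply/orP; exact: le_total.
  apply: withinU_continuous => //.
  + by apply: closedI => //; apply: closed_le_fun => //; exact: cst_continuous.
  + apply: (@subspace_eq_continuous _ _ _ (fun y => p y x)).
      by move=> y /set_mem[/l_small /gp gpy _]; rewrite /from_subspace gpy.
    by apply: continuous_subspaceW (cp x) => y [].
  + have clW A : {within A, continuous l} by exact: continuous_subspaceT.
    have cpZ : {within Z, continuous (fun y => p y x)}.
      exact: continuous_subspaceW (cp x).
    move=> y; apply: cvgD; apply: cvgM.
    * exact: clW.
    * exact: cF.
    * by apply: cvgB; [exact: cvg_cst|exact: clW].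
    * exact: cpZ.
- move=> y Dy; have [y2|/ltW y2] := leP (enorm y) 2^-1.
    by rewrite (gp y (l_small y y2)); exact: pK.
  have Zy : Z y by split.
  have /realization_IndP[p0 p1 _] := pK y Dy.
  have /realization_IndP[F0 F1 indF] := FK y Zy.
  apply/realization_IndP; split.
  + move=> x; apply: addr_ge0; first exact: mulr_ge0.
    by apply: mulr_ge0 => //; rewrite subr_ge0 l_le1.
  + by rewrite big_split /= -!mulr_sumr F1 p1 !mulr1 addrC subrK.
  + have gF x : g y x != 0 -> F y x != 0.
      apply: contra_neq => Fx.
      have px : p y x = 0 by apply: contra_eq Fx; exact: pF.
      by rewrite /g Fx px !mulr0 addr0.
    by move=> u v auv /gF Fu /gF; exact: indF auv Fu.
- move=> y /sphereP y1; apply/funext => x.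
  have ly : l y = 1 by rewrite /l y1 max_r mulr1 ?addrK ?ler01.
  by rewrite /g ly subrr mul0r addr0 mul1r /F y1 invr1 scale1r.
Qed.

Lemma cover_ext_connected (R : realType) (H : sgraph) (U : {set H}) (k : nat) :
  cover_ext R (~: U)%SET k ->
  scomplex_connected R (Ind (delete U)) (k%:Z - 2).
Proof.
move=> ext; split=> [k1|i ik f cf fK]; last first.
  have [||y Sy|g [cg gK fg]] := @cover_ext_disk R H U k i f ext.
  - lia.
  - exact: cf.
  - by apply: fK; exists y.
  exists g; split=> //; first by move=> _ [y Dy <-]; exact: gK.
  by move=> y /set_mem Sy; exact: fg.
(* For non-emptiness the empty cover is extended to a single point, which is thin of degree 1 in
   dimension 1; a set containing the point yields a vertex. *)
have [||||||D [_ subD covD _] _] := ext 1%N 1%N [set 0] set0 (fun=> set0).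
- exact: compact_set1.
- exists (fun=> [:: 0]) => y ->; apply/card_gt0P; exists ord0.
  by rewrite !inE mxE.
- lia.
- exact: closed0.
- by [].
- by split=> // v; exact: closed0.
have [v /subD[vU _]] := covD 0 erefl; rewrite inE in vU.
pose x0 : delete U := Sub v vU.
exists (fun x => (x == x0)%:R); apply/realization_IndP; split=> [x||u w].
- exact: ler0n.
- rewrite (bigD1 x0) //= eqxx big1 ?addr0 // => x /negbTE -> //.
- rewrite !pnatr_eq0 !eqb0 !negbK => auw /eqP ux /eqP wx.
  by rewrite ux wx adj_irr in auw.
Qed.

Theorem theorem3p5 (R : realType) (q m : nat) (G : sgraph)
  (w : 'I_m -> G) (S : 'I_m -> {set cart G (complete q)}) :
  (1 <= q)%N ->
  (m < #|G|)%N ->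
  (forall i, is_squid (w i) (S i)) ->
  injective w ->
  (forall v : G, (#|nbh2 v| + 2 * #|nbh v| < q)%N) ->
  scomplex_connected R (Ind (delete (\bigcup_(i < m) S i)%SET))
    (#|G|%:Z - m%:Z - 2)%R.
Proof.
move=> _ mG sqS injw ltq.
rewrite subzn ?(ltnW mG) //; apply: cover_ext_connected.
pose B := [set w i | i : 'I_m]%SET.
(* As [w] is injective, [S' (w i)] is just [S i]; this indexes the squids by their bodies. *)
pose S' b := (\bigcup_(i | w i == b) S i)%SET.
apply: (cover_ext_squids ltq (B := B)).
  exists S' => [_ /imsetP[i _ ->]|].
    by rewrite /S' (big_pred1 i) => // j; rewrite /= (inj_eq injw).
  rewrite big_imset /=; last by move=> i j _ _; exact: injw.
  apply: eq_bigr => i _.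
  by rewrite /S' (big_pred1 i) => // j; rewrite /= (inj_eq injw).
by rewrite card_imset // card_ord subnK // ltnW.
Qed.
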